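(* Consider the two-organization anonymous transfer protocol described in the context. For every honestly executed transaction (the $k$-th transfer) involving qualified subsets $S_1\subseteq[n_1]$ (sender side, $|S_1|\ge t_1$) and $S_2\subseteq[n_2]$ (receiver side, $|S_2|\ge t_2$), the one-time destination $D^{(k)}=B^{(k)}+\rho^{(k)}G$ produced by the sender in Phase I satisfies $$D^{(k)}=\Big(\sum_{j\in S_2}\lambda_{j,S_2}\,d_j^{(k)}\Big)G,$$ where $d_j^{(k)}=b_j^{(k)}+\rho^{(k)}$ are the one-time shares recovered by the receivers in Phase II (the receivers computing $\rho^{(k)}$ from their own value $\Omega'^{(k)}$). Furthermore, any qualified receiver-side subset can produce a valid threshold signature under the public key $D^{(k)}$, and all honest parties agree on the evolved derivation state $(B^{(k)},cc^{(k)})$.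
   Context: Let $\mathbb G$ be an (additively written) elliptic-curve group of prime order $q$ with generator $G$, let $H:\{0,1\}^*\to\mathbb Z_q$ be a hash function, and let $\parallel$ denote concatenation. For $S\subseteq[n]=\{1,\dots,n\}$ (with $n<q$) and $i\in S$, $\lambda_{i,S}=\prod_{j\in S,\,j\ne i}\frac{j}{j-i}\in\mathbb Z_q$. A scalar $x$ is Shamir-shared with threshold $t$ among $n$ parties if party $i$ holds $x_i=f(i)$ for a polynomial $f$ over $\mathbb Z_q$ of degree at most $t-1$ with $f(0)=x$; then $x=\sum_{i\in S}\lambda_{i,S}x_i$ for every $S$ with $|S|\ge t$ (such $S$ is called qualified). Keys. The sender organization has $n_1$ members, threshold $t_1$, a Shamir-shared secret $a$ with shares $a_i$, public shares $A_i=a_iG$ and public key $A=aG$. The receiver organization has $n_2$ members, threshold $t_2$, and a parent state consisting of Shamir shares $b_j^{(k-1)}$ of $b^{(k-1)}$, public shares $B_j^{(k-1)}=b_j^{(k-1)}G$, public key $B^{(k-1)}=b^{(k-1)}G$ and a chain code $cc^{(k-1)}$. Threshold-ECDSA interface. $\mathsf{TS.KeyGen}$ gives each party a local state $st_i$ (containing its share, public share and auxiliary data) for a public key $X=xG$. For a public offset $e$, $\mathsf{TS.Tweak}(st_i,e,X')$ produces a state for $X'=X+eG$ with share $x_i+e$ and public share $X_i+eG$. $\mathsf{TS.Sign}_S(m,\{st_i\}_{i\in S})$ is a signing protocol run by a qualified subset $S$ with fresh preprocessing for the current key, and $\mathsf{TS.Verify}(X,m,\sigma)\in\{0,1\}$.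 The interface is assumed correct: after any sequence of public additive tweaks, an honest run of $\mathsf{TS.Sign}_S$ by a qualified $S$ yields a signature accepted by $\mathsf{TS.Verify}$ under the tweaked public key. Protocol (honest execution with agreed inputs and delivered messages). Phase I. With a fresh public tag $\mathsf{id}^{(k)}$, compute $(\omega^{(k)},cc^{(k)})=\text{HMAC-SHA512}(cc^{(k-1)},B^{(k-1)}\parallel\mathsf{id}^{(k)})$, where the first half is read as a scalar $\omega^{(k)}\in\mathbb Z_q$ and the second half is $cc^{(k)}$. Set $B^{(k)}=B^{(k-1)}+\omega^{(k)}G$; each receiver sets $b_j^{(k)}=b_j^{(k-1)}+\omega^{(k)}$, $B_j^{(k)}=B_j^{(k-1)}+\omega^{(k)}G$ and tweaks its signing state by $\omega^{(k)}$. Each sender $i\in S_1$ computes $\Omega_i^{(k)}=a_iB^{(k)}$; the senders form $\Omega^{(k)}=\sum_{i\in S_1}\lambda_{i,S_1}\Omega_i^{(k)}$, sample a public label $\xi^{(k)}\in\{0,1\}^{256}$, and set $\rho^{(k)}=H(\Omega^{(k)}\parallel\xi^{(k)})$, $D^{(k)}=B^{(k)}+\rho^{(k)}G$. A qualified sender subset threshold-signs a payment to $D^{(k)}$ under $A$; the values $\mathsf{id}^{(k)},\xi^{(k)}$ are public. Phase II. Each receiver $j\in S_2$ computes $\Omega_j'^{(k)}=b_j^{(k)}A$; the receivers form $\Omega'^{(k)}=\sum_{j\in S_2}\lambda_{j,S_2}\Omega_j'^{(k)}$, recompute $\rho^{(k)}=H(\Omega'^{(k)}\parallel\xi^{(k)})$,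 and set $d_j^{(k)}=b_j^{(k)}+\rho^{(k)}$. Each receiver tweaks its signing state by $\rho^{(k)}$ to the key $D^{(k)}$, and a qualified subset signs a redemption message with fresh preprocessing. After the redemption transaction is confirmed, the parties commit $(B^{(k)},cc^{(k)})$ as the new public derivation state. *)

(* Defs.v *)
From HB Require Import structures.
From mathcomp Require Import all_boot all_order all_algebra.

Set Implicit Arguments.
Unset Strict Implicit.
Unset Printing Implicit Defensive.

Import GRing.Theory.
Local Open Scope ring_scope.

Notation bits := (seq bool).

(* [q] is prime and the group has order [q] wherever this is used, so this is
   the usual action of Z_q on the group. *)
Definition smul (q : nat) (V : zmodType) (x : 'F_q) (P : V) : V := P *+ x.

Notation "x ** P" := (smul x P) (at level 40, left associativity) : ring_scope.

(* Party [i : 'I_n] is the party numbered [i.+1] in {1, ..., n}. *)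
Definition pt (q n : nat) (i : 'I_n) : 'F_q := i.+1%:R.

Definition lambda (q n : nat) (S : {set 'I_n}) (i : 'I_n) : 'F_q :=
  \prod_(j in S | j != i) (pt q j / (pt q j - pt q i)).

Definition shamir (q n t : nat) (x : 'F_q) (xs : 'I_n -> 'F_q) : Prop :=
  exists f : {poly 'F_q},
    [/\ (size f <= t)%N, f.[0] = x & forall i, xs i = f.[pt q i]].

(* Big-endian integer reduced modulo [q]. *)
Definition scalar_of_bits (q : nat) (s : bits) : 'F_q :=
  (foldl (fun acc (b : bool) => (acc.*2 + b)%N) 0%N s)%:R.

(* The randomness consumed by one run of a protocol. *)
Definition tape : Type := nat -> bool.

(* [ts_sign S m st r] is the signature output by an honest run of the signing
   protocol among [S]; the tape [r] feeds its fresh preprocessing as well as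
   its online phase.  [ts_keygen n t r] returns the public key together with
   the local states of the [n] parties. *)
Record ts_scheme (q : nat) (gT : zmodType) : Type := TSScheme {
  ts_state : Type;
  ts_sig : Type;
  ts_share : ts_state -> 'F_q;
  ts_pubshare : ts_state -> gT;
  ts_pubkey : ts_state -> gT;
  ts_keygen : forall n t : nat, tape -> gT * ('I_n -> ts_state);
  ts_tweak : ts_state -> 'F_q -> gT -> ts_state;
  ts_sign : forall (n : nat) (S : {set 'I_n}),
    bits -> ({i : 'I_n | i \in S} -> ts_state) -> tape -> ts_sig;
  ts_verify : gT -> bits -> ts_sig -> bool
}.

Definition ts_run (q : nat) (gT : zmodType) (TS : ts_scheme q gT)
    (n : nat) (S : {set 'I_n}) (m : bits) (st : 'I_n -> ts_state TS)
    (r : tape) : ts_sig TS :=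
  ts_sign (S := S) m (fun i => st (sval i)) r.

(* [ts_reach TS G n t X st]: the family [st] of local states for the public
   key [X] comes from an honest key generation followed by a finite sequence
   of public additive tweaks. *)
Inductive ts_reach (q : nat) (gT : zmodType) (TS : ts_scheme q gT) (G : gT)
    (n t : nat) : gT -> ('I_n -> ts_state TS) -> Prop :=
| ts_reach_keygen (r : tape) :
    ts_reach G t (ts_keygen TS n t r).1 (ts_keygen TS n t r).2
| ts_reach_tweak (X : gT) (st st' : 'I_n -> ts_state TS) (e : 'F_q) :
    ts_reach G t X st ->
    (forall i, st' i = ts_tweak (st i) e (X + e ** G)) ->
    ts_reach G t (X + e ** G) st'.

Record ts_correct (q : nat) (gT : zmodType) (TS : ts_scheme q gT) (G : gT) :
    Prop := TSCorrect {
  ts_keygenP : forall (n t : nat) (r : tape), (0 < t <= n)%N -> (n < q)%N ->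
    let: (X, st) := ts_keygen TS n t r in
    exists x : 'F_q,
      [/\ X = x ** G,
          shamir t x (fun i => ts_share (st i))
        & forall i, ts_pubshare (st i) = ts_share (st i) ** G /\
                    ts_pubkey (st i) = X];
  ts_tweakP : forall (s : ts_state TS) (e : 'F_q) (X' : gT),
    X' = ts_pubkey s + e ** G ->
    [/\ ts_share (ts_tweak s e X') = ts_share s + e,
        ts_pubshare (ts_tweak s e X') = ts_pubshare s + e ** G
      & ts_pubkey (ts_tweak s e X') = X'];
  ts_signP : forall (n t : nat) (X : gT) (st : 'I_n -> ts_state TS),
    (0 < t <= n)%N -> (n < q)%N -> ts_reach G t X st ->
    forall (S : {set 'I_n}) (m : bits) (r : tape),
      (t <= #|S|)%N -> ts_verify X m (ts_run S m st r)
}.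

(* The functions and constants fixed once and for all.  [p_enc] serializes
   group elements; [p_pays m D] says that the message [m] is a payment to the
   one-time destination [D]. *)
Record params (q : nat) (gT : zmodType) : Type := Params {
  p_gen : gT;
  p_enc : gT -> bits;
  p_hash : bits -> 'F_q;
  p_hmac : bits -> bits -> 512.-tuple bool;
  p_pays : bits -> gT -> Prop;
  p_n1 : nat;
  p_t1 : nat;
  p_n2 : nat;
  p_t2 : nat;
  p_ts : ts_scheme q gT
}.

(* A derivation state (B, cc): current receiver public key and chain code. *)
Record dstate (gT : Type) : Type := DState { d_key : gT; d_cc : bits }.

Section Protocol.

Variables (q : nat) (gT : zmodType) (pp : params q gT).

Local Notation G := (p_gen pp).
Local Notation TS := (p_ts pp).
Local Notation n1 := (p_n1 pp).
Local Notation n2 := (p_n2 pp).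
Local Notation t1 := (p_t1 pp).
Local Notation t2 := (p_t2 pp).

Definition derive (ds : dstate gT) (id : bits) : 'F_q * dstate gT :=
  let h := tval (p_hmac pp (d_cc ds) (p_enc pp (d_key ds) ++ id)) in
  let omega := scalar_of_bits q (take 256 h) in
  (omega, DState (d_key ds + omega ** G) (drop 256 h)).

(* [inl i] is a sender, [inr j] a receiver. *)
Definition party : Type := ('I_n1 + 'I_n2)%type.

(* What the parties hold between two transfers.  Each party keeps its own
   copy [c_view] of the public derivation state, so that agreement between
   the parties is a property of a configuration rather than built in. *)
Record config : Type := Config {
  c_A : gT;
  c_snd : 'I_n1 -> ts_state TS;
  c_rcv : 'I_n2 -> ts_state TS;
  c_view : party -> dstate gT;
  c_used : seq bits
}.

(* The public values, the participating subsets, the randomness and the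
   messages and signatures of one transfer.  The signers of the payment and
   of the redemption need not be the subsets [x_S1], [x_S2] that reconstruct
   the shared secret. *)
Record transfer : Type := Transfer {
  x_id : bits;
  x_xi : 256.-tuple bool;
  x_S1 : {set 'I_n1};
  x_S2 : {set 'I_n2};
  x_payers : {set 'I_n1};
  x_pay_msg : bits;
  x_pay_tape : tape;
  x_pay_sig : ts_sig TS;
  x_redeemers : {set 'I_n2};
  x_red_msg : bits;
  x_red_tape : tape;
  x_red_sig : ts_sig TS
}.

Section OneTransfer.

Variables (c : config) (x : transfer).

Definition omega (p : party) : 'F_q := (derive (c_view c p) (x_id x)).1.

Definition new_view (p : party) : dstate gT :=
  (derive (c_view c p) (x_id x)).2.

Definition b_share (j : 'I_n2) : 'F_q :=
  ts_share (c_rcv c j) + omega (inr j).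

Definition rcv_state (j : 'I_n2) : ts_state TS :=
  ts_tweak (c_rcv c j) (omega (inr j)) (d_key (new_view (inr j))).

Definition Omega_snd_part (i : 'I_n1) : gT :=
  ts_share (c_snd c i) ** d_key (new_view (inl i)).

Definition Omega_snd : gT :=
  \sum_(i in x_S1 x) lambda q (x_S1 x) i ** Omega_snd_part i.

Definition rho_snd : 'F_q := p_hash pp (p_enc pp Omega_snd ++ x_xi x).

(* The destination as computed by sender [i]. *)
Definition dest (i : 'I_n1) : gT :=
  d_key (new_view (inl i)) + rho_snd ** G.

Definition Omega_rcv_part (j : 'I_n2) : gT := b_share j ** c_A c.

Definition Omega_rcv : gT :=
  \sum_(j in x_S2 x) lambda q (x_S2 x) j ** Omega_rcv_part j.

Definition rho_rcv : 'F_q := p_hash pp (p_enc pp Omega_rcv ++ x_xi x).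

Definition d_share (j : 'I_n2) : 'F_q := b_share j + rho_rcv.

Definition onetime_state (j : 'I_n2) : ts_state TS :=
  ts_tweak (rcv_state j) rho_rcv (d_key (new_view (inr j)) + rho_rcv ** G).

Record honest : Prop := Honest {
  honest_fresh : x_id x \notin c_used c;
  honest_S1 : (t1 <= #|x_S1 x|)%N;
  honest_S2 : (t2 <= #|x_S2 x|)%N;
  honest_payers : (t1 <= #|x_payers x|)%N;
  honest_pays : forall i, i \in x_payers x -> p_pays pp (x_pay_msg x) (dest i);
  honest_pay_sig :
    x_pay_sig x = ts_run (x_payers x) (x_pay_msg x) (c_snd c) (x_pay_tape x);
  honest_redeemers : (t2 <= #|x_redeemers x|)%N;
  honest_red_sig :
    x_red_sig x =
      ts_run (x_redeemers x) (x_red_msg x) onetime_state (x_red_tape x)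
}.

(* The tweak by rho is one-time: the next transfer starts from the states for
   the key B, not from those for the destination. *)
Definition commit : config :=
  {| c_A := c_A c;
     c_snd := c_snd c;
     c_rcv := rcv_state;
     c_view := new_view;
     c_used := x_id x :: c_used c |}.

End OneTransfer.

(* [history k c]: [c] is reached after [k] honest transfers.  At the start
   both organizations hold correctly generated, possibly already tweaked keys
   and all parties know the same public key and chain code. *)
Inductive history : nat -> config -> Prop :=
| history_init (A B : gT) (snd : 'I_n1 -> ts_state TS)
    (rcv : 'I_n2 -> ts_state TS) (cc : bits) (used : seq bits) :
    ts_reach G t1 A snd -> ts_reach G t2 B rcv ->
    history 0 (Config A snd rcv (fun _ => DState B cc) used)
| history_step (k : nat) (c : config) (x : transfer) :
    history k c -> honest c x -> history k.+1 (commit c x).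

End Protocol.

(* Main.v *)
(** Lagrange interpolation at 0 reconstructs the secret from any qualified set of
    shares, so the senders obtain [Omega = a B] and the receivers [Omega' = b A];
    both are [(a b) G], hence both sides hash to the same [rho].  Adding a
    public constant to every share shifts the shared secret by that constant,
    so the [d_j] share [b + rho], whose public key is the destination.  The
    one-time signing states are therefore reached from an honest key generation
    by public tweaks and sign correctly. *)
Require Import Defs.
From HB Require Import structures.
From mathcomp Require Import all_boot all_order all_algebra fingroup cyclic.

Set Implicit Arguments.
Unset Strict Implicit.
Unset Printing Implicit Defensive.

Import GRing.Theory.
Local Open Scope ring_scope.

Section ScalarAction.

Variables (q : nat) (gT : finZmodType).
Hypotheses (q_prime : prime q) (gT_order : #|gT| = q).
Implicit Types (x y : 'F_q) (P Q : gT).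

(** ['F_q] reduces its representatives modulo [(Zp_trunc (pdiv q)).+2], which is [q] for prime [q];
    the group order [q] annihilates [P]. *)
Lemma mulrn_modFp P n : P *+ (n %% (Zp_trunc (pdiv q)).+2) = P *+ n.
Proof.
rewrite Fp_cast //.
have Pq0 : P *+ q = 0.
  (* The additive group is viewed as a multiplicative finite group to apply Lagrange's theorem. *)
  have := @expg_cardG gT [set: gT] P (in_setT P).
  by rewrite cardsT gT_order FinRing.zmodXgE.
by rewrite [in RHS](divn_eq n q) mulrnDr mulnC mulrnA Pq0 mul0rn add0r.
Qed.

Lemma smulDl x y P : (x + y) ** P = x ** P + y ** P.
Proof. by rewrite /smul -mulrnDr /= mulrn_modFp. Qed.

Lemma smulA x y P : x ** (y ** P) = (x * y) ** P.
Proof. by rewrite /smul -mulrnA /= mulrn_modFp mulnC. Qed.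

Lemma smul_suml (I : finType) (S : {pred I}) (F : I -> 'F_q) P :
  (\sum_(i in S) F i) ** P = \sum_(i in S) F i ** P.
Proof.
apply: (big_ind2 (fun Q x => x ** P = Q)) => // Q x R y <- <-.
exact: smulDl.
Qed.

End ScalarAction.

Section Shamir.

Variables (q n : nat).
Hypotheses (q_prime : prime q) (n_lt_q : (n < q)%N).

(** The labels [1, ..., n] lie below [q], so reduction modulo [q] keeps them distinct. *)
Lemma pt_inj : injective (@pt q n).
Proof.
move=> i j /(congr1 val) /=; rewrite !val_Fp_nat // !modn_small.
- by case=> /val_inj.
- by rewrite (leq_ltn_trans (ltn_ord j)).
- by rewrite (leq_ltn_trans (ltn_ord i)).
Qed.

(** Each factor is a scalar times a monic linear polynomial, so the scalars can be pulled out and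
    the size read off the roots. *)
Definition lagrange_basis (S : {set 'I_n}) (i : 'I_n) : {poly 'F_q} :=
  \prod_(j in S | j != i) ((pt q i - pt q j)^-1 *: ('X - (pt q j)%:P)).

Lemma lagrange_basis0 S i : (lagrange_basis S i).[0] = lambda q S i.
Proof.
rewrite horner_prod; apply: eq_bigr => j _.
by rewrite hornerZ hornerXsubC sub0r mulrN -mulNr -invrN opprB mulrC.
Qed.

Lemma lagrange_basis_pt (S : {set 'I_n}) i j :
  j \in S -> (lagrange_basis S i).[pt q j] = (i == j)%:R.
Proof.
move=> jS; rewrite horner_prod; have [<-|ij] := eqVneq i j.
  apply: big1 => k /andP[_ ki]; rewrite hornerZ hornerXsubC mulVf //.
  by rewrite subr_eq0 (inj_eq pt_inj) eq_sym.
rewrite (bigD1 j) /=; last by rewrite jS eq_sym.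
by rewrite hornerZ hornerXsubC subrr mulr0 mul0r.
Qed.

Lemma size_lagrange_basis (S : {set 'I_n}) i :
  i \in S -> (size (lagrange_basis S i) <= #|S|)%N.
Proof.
move=> iS; rewrite /lagrange_basis scaler_prod.
apply: leq_trans (size_scale_leq _ _) _.
(* The monic product has one root for each element of [S] other than [i], and its size is one more
   than that number. *)
rewrite -big_filter size_prod_XsubC -sum1_size big_filter.
rewrite (cardsD1 i) iS add1n ltnS -sum1_card eq_leq //.
by apply: eq_bigl => j; rewrite !inE andbC.
Qed.

(** The sharing polynomial and its interpolant [g] on [S] have size at most [#|S|] and agree at
    [#|S|] distinct points, so they coincide, in particular at 0. *)
Lemma shamir_reconstruct t (x : 'F_q) (xs : 'I_n -> 'F_q) (S : {set 'I_n}) :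
  shamir t x xs -> (t <= #|S|)%N -> \sum_(i in S) lambda q S i * xs i = x.
Proof.
case=> f [size_f <- xsE] tS.
pose g := \sum_(i in S) xs i *: lagrange_basis S i.
suff fg : f = g.
  rewrite fg horner_sum; apply: eq_bigr => i _.
  by rewrite hornerZ lagrange_basis0 mulrC.
apply/eqP; rewrite -subr_eq0; apply/eqP.
apply: (@roots_geq_poly_eq0 _ _ [seq pt q i | i <- enum S]).
- apply/allP => z /mapP[j]; rewrite mem_enum => jS ->.
  rewrite rootE hornerD hornerN horner_sum (bigD1 j) //= hornerZ.
  rewrite lagrange_basis_pt // eqxx mulr1 xsE big1 ?addr0 ?subrr // => i.
  by case/andP=> _ /negPf ij; rewrite hornerZ lagrange_basis_pt // ij mulr0.
- by rewrite map_inj_uniq ?enum_uniq //; exact: pt_inj.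
rewrite size_map -cardE (leq_trans (size_polyD _ _)) // size_polyN geq_max.
rewrite (leq_trans size_f tS) /=; apply: (leq_trans (size_sum _ _ _)).
apply/bigmax_leqP => i iS.
exact: leq_trans (size_scale_leq _ _) (size_lagrange_basis iS).
Qed.

(** Adding the constant [e] to the polynomial may raise its size to 1, which [0 < t] allows. *)
Lemma shamirD t (x e : 'F_q) (xs : 'I_n -> 'F_q) :
  (0 < t)%N -> shamir t x xs -> shamir t (x + e) (fun i => xs i + e).
Proof.
move=> t_gt0 [f [size_f f0 xsE]]; exists (f + e%:P); split=> [||i].
- rewrite (leq_trans (size_polyD _ _)) // geq_max size_f.
  by rewrite (leq_trans (size_polyC_leq1 _)).
- by rewrite hornerD hornerC f0.
- by rewrite hornerD hornerC xsE.
Qed.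

End Shamir.

(** The conjunct on [ts_pubkey] carries the induction: [ts_tweakP] applies only when the target key
    is the recorded key shifted by [e ** G]. *)
Lemma ts_reach_shamir (q : nat) (gT : finZmodType) (TS : ts_scheme q gT)
    (G : gT) (n t : nat) (X : gT) (st : 'I_n -> ts_state TS) :
  prime q -> #|gT| = q -> (0 < t <= n)%N -> (n < q)%N -> ts_correct TS G ->
  ts_reach G t X st ->
  exists x : 'F_q,
    [/\ X = x ** G, shamir t x (fun i => ts_share (st i))
      & forall i, ts_pubkey (st i) = X].
Proof.
move=> q_prime gT_order t_range n_lt_q TS_correct.
elim=> [r|Y s s' e _ [y [YE y_s Ys]] s'E].
  have := ts_keygenP TS_correct r t_range n_lt_q.
  by case: ts_keygen => Y s [y [? ? Ys]]; exists y; split=> // i; case: (Ys i).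
have tweakP i : [/\ ts_share (s' i) = ts_share (s i) + e
                  & ts_pubkey (s' i) = Y + e ** G].
  rewrite s'E; case: (ts_tweakP TS_correct (s := s i) (e := e)
                       (X' := Y + e ** G)) => //.
  by rewrite Ys.
exists (y + e); split=> [||i]; last by case: (tweakP i).
  by rewrite YE smulDl.
have [t_gt0 _] := andP t_range.
(* The new shares equal the shifted ones only pointwise, so the polynomial is unpacked and supplied
   again. *)
have [f [size_f f0 fE]] := shamirD e t_gt0 y_s.
by exists f; split=> // i; case: (tweakP i) => -> _; apply: fE.
Qed.

(** Agreement on the view makes all receivers tweak by one scalar towards one key, as
    [ts_reach_tweak] requires; hence the two invariants are proved together. *)
Lemma history_invariant (q : nat) (gT : zmodType) (pp : params q gT)
    (k : nat) (c : config pp) :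
  history k c ->
  exists2 ds, forall p, c_view c p = ds
    & ts_reach (p_gen pp) (p_t1 pp) (c_A c) (c_snd c) /\
      ts_reach (p_gen pp) (p_t2 pp) (d_key ds) (c_rcv c).
Proof.
elim=> [A B snd rcv cc used sndP rcvP|{}k {}c x _ [ds viewE [sndP rcvP]] _].
  by exists (DState B cc).
exists (derive pp ds (x_id x)).2 => [p|]; first by rewrite /= /new_view viewE.
split=> //=; apply: ts_reach_tweak rcvP _ => j.
by rewrite /rcv_state /omega /new_view viewE.
Qed.

Theorem theorem1 (q : nat) (gT : finZmodType) (pp : params q gT)
  (q_prime : prime q)
  (gT_order : #|gT| = q)
  (G_generator : forall P : gT, exists x : 'F_q, P = x ** p_gen pp)
  (t1_range : (0 < p_t1 pp <= p_n1 pp)%N) (n1_lt_q : (p_n1 pp < q)%N)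
  (t2_range : (0 < p_t2 pp <= p_n2 pp)%N) (n2_lt_q : (p_n2 pp < q)%N)
  (TS_correct : ts_correct (p_ts pp) (p_gen pp))
  (k : nat) (k_gt0 : (0 < k)%N) (c : config pp) (x : transfer pp)
  (c_history : history k.-1 c) (x_honest : honest c x) :
  [/\ forall i : 'I_(p_n1 pp),
        dest c x i =
          (\sum_(j in x_S2 x) lambda q (x_S2 x) j * d_share c x j)
            ** p_gen pp,
      forall (i : 'I_(p_n1 pp)) (S : {set 'I_(p_n2 pp)}) (m : bits) (r : tape),
        (p_t2 pp <= #|S|)%N ->
        ts_verify (dest c x i) m (ts_run S m (onetime_state c x) r)
    & forall p p' : party pp, c_view (commit c x) p = c_view (commit c x) p'].
Proof.
have [ds viewE [sndP rcvP]] := history_invariant c_history.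
set om := (derive pp ds (x_id x)).1.
set B := d_key ds + om ** p_gen pp.
have keyE p : d_key (new_view c x p) = B by rewrite /new_view viewE.
have omE p : omega c x p = om by rewrite /omega viewE.
have rcvP' : ts_reach (p_gen pp) (p_t2 pp) B (rcv_state c x).
  by apply: ts_reach_tweak rcvP _ => j; rewrite /rcv_state keyE omE.
have [a [AE a_shares _]] :=
  ts_reach_shamir q_prime gT_order t1_range n1_lt_q TS_correct sndP.
have [b0 [B0E b0_shares _]] :=
  ts_reach_shamir q_prime gT_order t2_range n2_lt_q TS_correct rcvP.
have [t2_gt0 _] := andP t2_range.
have b_shares : shamir (p_t2 pp) (b0 + om) (b_share c x).
  have [f [size_f f0 fE]] := shamirD om t2_gt0 b0_shares.
  by exists f; split=> // j; rewrite /b_share omE.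
have BE : B = (b0 + om) ** p_gen pp by rewrite smulDl // -B0E.
(* Both reconstructions are brought to this one scalar multiple of the generator. *)
have Omega_sndE : Omega_snd c x = (a * (b0 + om)) ** p_gen pp.
  rewrite -smulA // -BE.
  rewrite -(shamir_reconstruct q_prime n1_lt_q a_shares (honest_S1 x_honest)).
  rewrite smul_suml //; apply: eq_bigr => i _.
  by rewrite /Omega_snd_part keyE smulA.
have Omega_rcvE : Omega_rcv c x = (a * (b0 + om)) ** p_gen pp.
  rewrite mulrC -smulA // -AE.
  rewrite -(shamir_reconstruct q_prime n2_lt_q b_shares (honest_S2 x_honest)).
  by rewrite smul_suml //; apply: eq_bigr => j _; rewrite smulA.
have rhoE : rho_snd c x = rho_rcv c x.
  by rewrite /rho_snd /rho_rcv Omega_sndE Omega_rcvE.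
have destE i : dest c x i = B + rho_rcv c x ** p_gen pp.
  by rewrite /dest keyE rhoE.
split=> [i|i S m r S_ge|p p'].
(* [d_share] unfolds to these shifted shares, whose secret is [b0 + om + rho_rcv c x]. *)
- have d_shares := shamirD (rho_rcv c x) t2_gt0 b_shares.
  rewrite (shamir_reconstruct q_prime n2_lt_q d_shares (honest_S2 x_honest)).
  by rewrite destE [RHS]smulDl // -BE.
- rewrite destE; apply: (ts_signP TS_correct t2_range n2_lt_q) => //.
  (* This is the second tweak of the transfer, from the key [B] to the destination. *)
  apply: ts_reach_tweak rcvP' _ => j.
  by rewrite /onetime_state keyE.
- by rewrite /= /new_view !viewE.
Qed.
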